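(* Let $0<\alpha<1$, $\nu>0$, $T>1$, let $G\subset\mathbb{R}^n$ be a bounded domain with smooth boundary $\partial G$, and put $\Omega=G\times(1,T]$. Let $F:\overline\Omega\times\mathbb{R}\to\mathbb{R}$, $\psi:\partial G\times[1,T]\to\mathbb{R}$ and $g_1,g_2:\bar G\to\mathbb{R}$ be continuous. Let $u_1$ and $u_2$ be two solutions of $$D_{*,t}^{\alpha}u(x,t)=\nu\Delta_x u(x,t)+F(x,t,u(x,t)),\quad (x,t)\in\Omega,$$ that satisfy the same boundary condition $u_i(x,t)=\psi(x,t)$ for $x\in\partial G$, $1\le t\le T$ ($i=1,2$), and the initial conditions $u_1(x,1)=g_1(x)$ and $u_2(x,1)=g_2(x)$, $x\in\bar G$. If $F(x,t,u)$ is nonincreasing with respect to $u$, then $$\|u_1-u_2\|_{C(\overline\Omega)}\ \le\ \|g_1-g_2\|_{C(\bar G)} .$$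
   Context: $\Delta_x u=\sum_{j=1}^n\partial^2u/\partial x_j^2$, $\overline\Omega=\bar G\times[1,T]$, $\|\cdot\|_{C(K)}$ is the sup norm on $K$, and $D_{*,t}^{\alpha}$ is the Hadamard-type fractional derivative in $t$ with base point $1$: $$D_{*,t}^{\alpha}u(x,t)=\frac{1}{\Gamma(1-\alpha)}\int_1^t\left(\log\frac{t}{s}\right)^{-\alpha}\frac{\partial u}{\partial s}(x,s)\,ds .$$ Solutions are classical: $u\in C(\overline\Omega)$ is real-valued, $u(\cdot,t)\in C^2(G)$ for each $t\in(1,T]$, $u(x,\cdot)\in W^1_2([1,T])$ (Sobolev space) for each $x\in G$, the integral defining $D_{*,t}^{\alpha}u(x,t)$ converges absolutely at every $(x,t)\in\Omega$, and the equation holds at every point of $\Omega$. *)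

(* Defs.v *)
From mathcomp Require Import all_boot all_order all_algebra.
From mathcomp Require Import all_classical all_reals all_analysis.

Set Implicit Arguments.
Unset Strict Implicit.
Unset Printing Implicit Defensive.

Import Order.TTheory GRing.Theory Num.Theory.
Import numFieldNormedType.Exports.

Local Open Scope classical_set_scope.
Local Open Scope ring_scope.

(* Functions given on a subset of R^n, of [1, T] or of R^n * [1, T] are encoded
   as total functions; every definition below only constrains them, and every
   conclusion only reads them, on the relevant subset. *)

Definition boundary (X : topologicalType) (A : set X) : set X :=
  closure A `\` A°.

Definition sup_norm (R : realType) (X : Type) (K : set X) (f : X -> R) : R :=
  sup [set `|f x| | x in K].

Definition partial (R : realType) (n : nat) (j : 'I_n) (f : 'rV[R]_n -> R) :
  'rV[R]_n -> R := 'D_(delta_mx 0 j) f.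

(* Meant for an open set U, where partial derivatives at a point of U only
   depend on the restriction of f to U. *)
Fixpoint class_C (R : realType) (n : nat) (k : nat) (U : set 'rV[R]_n)
    (f : 'rV[R]_n -> R) : Prop :=
  (forall x, U x -> {for x, continuous f}) /\
  if k is k'.+1 then
    forall j : 'I_n,
      (forall x, U x -> derivable f x (delta_mx 0 j)) /\
      class_C k' U (partial j f)
  else True.

Definition class_Coo (R : realType) (n : nat) (U : set 'rV[R]_n)
    (f : 'rV[R]_n -> R) : Prop := forall k, class_C k U f.

Definition laplacian (R : realType) (n : nat) (f : 'rV[R]_n -> R)
    (x : 'rV[R]_n) : R := \sum_(j < n) partial j (partial j f) x.

(* Near each boundary point, G is the sublevel set of a C^oo local defining
   function with nonvanishing gradient. *)
Definition smooth_boundary (R : realType) (n : nat) (G : set 'rV[R]_n) : Prop :=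
  forall p, boundary G p ->
    exists (V : set 'rV[R]_n) (rho : 'rV[R]_n -> R),
      [/\ open V, V p, class_Coo V rho,
          (forall x, V x -> exists j : 'I_n, partial j rho x != 0) &
          G `&` V = [set x | V x /\ rho x < 0]].

Record smooth_bounded_domain (R : realType) (n : nat) (G : set 'rV[R]_n) :
    Prop := SmoothBoundedDomain {
  domain_nonempty : G !=set0 ;
  domain_open : open G ;
  domain_connected : connected G ;
  domain_bounded : bounded_set G ;
  domain_smooth : smooth_boundary G }.

Definition test_function (R : realType) (a b : R) (phi : R -> R) : Prop :=
  [/\ forall k s, derivable (phi^`(k))%classic s 1,
      compact (closure [set s | phi s != 0]) &
      closure [set s | phi s != 0] `<=` `]a, b[ ].

Definition square_integrable (R : realType) (a b : R) (f : R -> R) : Prop :=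
  measurable_fun `]a, b[ f /\
  (@lebesgue_measure R).-integrable `]a, b[ (fun s => (f s ^+ 2)%:E).

Definition L2_weak_derivative (R : realType) (a b : R) (f g : R -> R) : Prop :=
  square_integrable a b g /\
  forall phi, test_function a b phi ->
    \int[@lebesgue_measure R]_(s in `]a, b[) (f s * (phi^`())%classic s) =
    - \int[@lebesgue_measure R]_(s in `]a, b[) (g s * phi s).

Definition W12 (R : realType) (a b : R) (f : R -> R) : Prop :=
  square_integrable a b f /\ exists g, L2_weak_derivative a b f g.

(* A representative of the derivative of f in W12; it is determined up to
   equality almost everywhere on ]a, b[. *)
Definition weak_deriv (R : realType) (a b : R) (f : R -> R) : R -> R :=
  xget (cst 0) [set g : R -> R | L2_weak_derivative a b f g].

Definition Gamma (R : realType) (z : R) : R :=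
  \int[@lebesgue_measure R]_(s in `]0, +oo[) (s `^ (z - 1) * expR (- s)).

Definition hadamard_integrand (R : realType) (T alpha : R) (f : R -> R)
    (t s : R) : R := ln (t / s) `^ (- alpha) * weak_deriv 1 T f s.

(* [T] is the right end of the interval on which f belongs to W12. *)
Definition hadamard_deriv (R : realType) (T alpha : R) (f : R -> R) (t : R) :
    R :=
  (Gamma (1 - alpha))^-1 *
  \int[@lebesgue_measure R]_(s in `[1, t]) hadamard_integrand T alpha f t s.

Definition closed_cylinder (R : realType) (n : nat) (G : set 'rV[R]_n) (T : R) :
    set ('rV[R]_n * R) := closure G `*` `[1, T].

Record classical_solution (R : realType) (n : nat) (alpha nu T : R)
    (G : set 'rV[R]_n) (F : 'rV[R]_n -> R -> R -> R) (u : 'rV[R]_n -> R -> R) :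
    Prop := ClassicalSolution {
  solution_continuous :
    {within closed_cylinder G T, continuous (fun p => u p.1 p.2)} ;
  solution_C2 : forall t, 1 < t <= T -> class_C 2 G (u ^~ t) ;
  solution_W12 : forall x, G x -> W12 1 T (u x) ;
  solution_integrable : forall x t, G x -> 1 < t <= T ->
    (@lebesgue_measure R).-integrable `[1, t]
      (fun s => (hadamard_integrand T alpha (u x) t s)%:E) ;
  solution_equation : forall x t, G x -> 1 < t <= T ->
    hadamard_deriv T alpha (u x) t =
    nu * laplacian (u ^~ t) x + F x t (u x t) }.

(* Main.v *)
Require Import Defs.
From mathcomp Require Import all_boot all_order all_algebra.
From mathcomp Require Import all_classical all_reals all_analysis measurable_realfun.
From mathcomp Require Import ring lra.

Set Implicit Arguments.
Unset Strict Implicit.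
Unset Printing Implicit Defensive.

Import Order.TTheory GRing.Theory Num.Theory.
Import numFieldNormedType.Exports.

Local Open Scope classical_set_scope.
Local Open Scope ring_scope.

(** Let M be the norm of g1 - g2 and suppose that u1 - u2 exceeds M somewhere.
    By compactness it has a maximum over the closed cylinder, at some (x0, t0).
    As u1 - u2 vanishes on the lateral boundary and is at most M at time 1, x0
    is interior and t0 > 1. There the Laplacian of u1 - u2 is at most 0
    ([laplacian_le_at_max]), and u1 > u2 gives F(x0, t0, u1) <= F(x0, t0, u2) by
    monotonicity; so the equations give D u1 <= D u2 at (x0, t0). But the
    Hadamard derivative satisfies a strict extremum principle
    ([hadamard_deriv_lt]): f = u1(x0, .) - u2(x0, .) being maximal at t0,
      Gamma (1 - alpha) D f (t0) >= (ln t0)^(- alpha) (f(t0) - f(1)) > 0,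
    a contradiction ([comparison_principle]). Exchanging u1 and u2 bounds the
    absolute value.

    The extremum principle is formally an integration by parts of the kernel
    k(s) = (ln (t0 / s))^(- alpha) against f': since k increases and f(t0) - f
    is nonnegative, the integral of k f' is at least k(1) (f(t0) - f(1)). As f'
    is only a weak derivative and k blows up at t0, the proof goes otherwise.
    The kernel is approximated from below by staircases, whose integrals against
    f' are sums of tail integrals of f', and the assumed integrability of k f'
    allows passing to the limit ([monotone_kernel_le]). The tail integrals are
    increments of f, that is, the fundamental theorem of calculus holds for the
    weak derivative of a continuous function, up to the endpoints
    ([weak_deriv_FTC]); it follows from testing against smooth cutoffs of
    intervals, built from exp(-1/((s - c) (d - s))) ([smooth_step_exists]).
    Finally Gamma (1 - alpha) > 0 has to be known, finiteness of the integral
    included, for the normalising constant to have the right sign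
    ([Gamma_gt0]). *)

(** * Functions flattened by exp(-1/p) at the zeros of a polynomial p *)

Section flat.
Context {R : realType}.
Implicit Types (p q : {poly R}) (s : R).

(** The functions q p^-m exp(-1/p), extended by 0 to where p <= 0. For a fixed p
    they form a family stable under differentiation, which gives derivatives of
    all orders without any product or quotient rule for smooth functions. *)
Definition flat p q m s : R :=
  if 0 < p.[s] then q.[s] / p.[s] ^+ m * expR (- (p.[s])^-1) else 0.

(** One term of the exponential series of 1/x bounds exp(1/x) from below; so
    exp(-1/x) vanishes at 0 faster than every power of x. *)
Lemma expR_invN_le (x : R) n : 0 < x -> expR (- x^-1) <= n.+1`!%:R * x ^+ n.+1.
Proof.
move=> x0.
have h := expR_ge1Dxn n (ltW (eqbRL (invr_gt0 x) x0)).
have f0 : 0 < (n.+1)`!%:R :> R by rewrite ltr0n fact_gt0.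
rewrite expRN -[leRHS]invrK.
rewrite lef_pV2 ?posrE ?expR_gt0 ?invr_gt0 ?mulr_gt0 ?exprn_gt0//.
rewrite invfM -exprVn mulrC.
by apply: le_trans h; rewrite lerDr.
Qed.

(** The numerator of the derivative of q p^-m exp(-1/p), once everything is put
    over the denominator p^(m+2). *)
Definition flat_next p q m : {poly R} :=
  q^`() * p ^+ 2 - (m%:R%:P * q * p * p^`()) + q * p^`().

(** Only the points s with p(s) = 0 need an argument. There p = r (X - s), and
    exp(-1/p) = O(p^(m+2)) makes the difference quotient O(q r^2 (X - s)). *)
Lemma is_derive_flat p q m s :
  is_derive s 1 (flat p q m) (flat p (flat_next p q m) m.+2 s).
Proof.
have pc : {for s, continuous (horner p)} by exact: continuous_horner.
have [ps|ps|ps] := ltgtP (p.[s]) 0.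
- rewrite {2}/flat ltNge (ltW ps)/=.
  apply: (near_eq_is_derive _ (is_derive_cst (0 : R) s 1)).
  near=> x; have px : p.[x] < 0 by near: x; exact: (cvgr_lt _ pc).
  by rewrite /flat ltNge (ltW px).
- rewrite {2}/flat ps/=.
  have p0 : p.[s] != 0 by rewrite gt_eqF.
  have d1 : is_derive s 1 (fun x => expR (- p.[x]^-1))
      (expR (- p.[s]^-1) * (p^`().[s] / p.[s] ^+ 2)).
    apply: (@is_derive1_comp _ expR (fun x => - p.[x]^-1)).
    have dN := is_deriveN (is_deriveV p0 (is_derive_poly p s)).
    apply: (is_derive_eq dN).
    by rewrite scaleNr opprK /GRing.scale/= mulrC.
  have pm0 : p.[s] ^+ m != 0 by rewrite expf_neq0.
  have dm : is_derive s 1 (fun x => p.[x] ^+ m) (m%:R * p.[s] ^+ m.-1 * p^`().[s]).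
    have := @is_deriveX _ _ (horner p) m s 1 _ (is_derive_poly p s).
    rewrite fctE => h; apply: (is_derive_eq h).
    by [].
  have dv := @is_deriveV _ (fun x => p.[x] ^+ m) s _ 1 pm0 dm.
  have h := is_deriveM (is_deriveM (is_derive_poly q s) dv) d1.
  have {}h := near_eq_is_derive _ h.
  apply: (is_derive_eq (h _ _)).
    near=> x; have px : 0 < p.[x] by near: x; exact: (cvgr_gt _ pc).
    by rewrite !fctE /flat px.
  rewrite /GRing.scale/= /flat_next !hornerE.
  set e := expR _. set P := p.[s]. set P' := p^`().[s].
  case: m {pm0 dm dv h} => [|m] /=.
    by rewrite !fctE !expr0 -/P; field; rewrite /P p0.
  by rewrite !fctE -/P !exprS; field; rewrite /P p0/= expf_neq0.
- rewrite {2}/flat ps ltxx.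
  have /factor_theorem[r pE] : root p s by exact/eqP.
  have C0 : 0 <= (m.+2)`!%:R :> R by [].
  (* Caratheodory: the slope, with value 0 at s, has to be continuous at s. *)
  apply/is_derive1_caratheodory; exists (fun z => flat p q m z / (z - s)); split.
  + move=> z; rewrite {2}/flat ps ltxx subr0.
    have [->|zs] := eqVneq z s; last by rewrite divfK// subr_eq0.
    by rewrite subrr mulr0 /flat ps ltxx.
  + rewrite /prop_for /continuous_at.
    have -> : flat p q m s / (s - s) = 0 by rewrite subrr invr0 mulr0.
    pose b z := `| (m.+2)`!%:R * (q * r ^+ 2 * ('X - s%:P)).[z] |.
    have b0 : b z @[z --> s] --> (0 : R).
      have -> : 0 = b s by rewrite /b !hornerE subrr /= !mulr0 normr0.
      apply: (@continuous_comp _ _ _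
        (fun z => (m.+2)`!%:R * (q * r ^+ 2 * ('X - s%:P)).[z]) Num.norm);
        last exact: norm_continuous.
      by apply: cvgMl_tmp; exact: continuous_horner.
    have Nb0 : - b z @[z --> s] --> (0 : R) by rewrite -oppr0; exact: cvgN.
    apply: (squeeze_cvgr _ Nb0 b0); apply: nearW => z.
    rewrite -ler_norml /flat; case: ifPn => pz; last by rewrite mul0r normr0 normr_ge0.
    have zs : z - s != 0.
      by apply: contraTneq pz => zs; rewrite pE !hornerE zs mulr0 ltxx.
    have pzE : p.[z] = r.[z] * (z - s) by rewrite pE !hornerE.
    have -> : b z = (m.+2)`!%:R * `|q.[z] * r.[z] ^+ 2 * (z - s)|.
      by rewrite /b normrM ger0_norm// !hornerE /= -!mulrA.
    rewrite normrM normfV !normrM !normfV ler_pdivrMr ?normr_gt0//.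
    rewrite [`|expR _|]ger0_norm ?expR_ge0//.
    apply: (@le_trans _ _ (`|q.[z]| / `|p.[z] ^+ m| * (m.+2`!%:R * p.[z] ^+ m.+2))).
      by apply: ler_wpM2l; [rewrite mulr_ge0 ?invr_ge0|exact: expR_invN_le].
    rewrite [`|p.[z] ^+ m|]ger0_norm ?exprn_ge0 ?(ltW pz)//.
    have -> : `|q.[z]| / p.[z] ^+ m * ((m.+2)`!%:R * p.[z] ^+ m.+2) =
        (m.+2)`!%:R * `|q.[z]| * p.[z] ^+ 2.
      by rewrite -addn2 exprD; field; rewrite expf_neq0 ?gt_eqF.
    have -> : p.[z] = `|r.[z]| * `|z - s| by rewrite -normrM -pzE gtr0_norm.
    by rewrite le_eqVlt; apply/orP; left; apply/eqP; ring.
  + by rewrite subrr invr0 mulr0.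
Unshelve. all: by end_near. Qed.

Lemma derive1n_flat p q m k : exists q' m', ((flat p q m)^`(k))%classic = flat p q' m'.
Proof.
elim: k => [|k [q' [m' IH]]]; first by exists q, m; rewrite derive1n0.
exists (flat_next p q' m'), m'.+2.
rewrite derive1nS IH; apply/funext => s; rewrite derive1E.
have d := is_derive_flat p q' m' s; exact: derive_val.
Qed.
End flat.

(** * Smooth steps *)

(** A smooth function that climbs from 0 to 1 inside [c, d]; its derivative is
    a smooth probability density carried by that interval. *)
Record smooth_step (R : realType) (c d : R) (B : R -> R) : Prop := SmoothStep {
  step_derivable : forall k s, derivable (B^`(k))%classic s 1 ;
  step_deriv_ge0 : forall s, 0 <= (B^`())%classic s ;
  step_deriv_out : forall s, (s <= c) || (d <= s) -> (B^`())%classic s = 0 ;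
  step0 : forall s, s <= c -> B s = 0 ;
  step1 : forall s, d <= s -> B s = 1 }.

Arguments step_derivable {R c d B} _ k s.

Section bump.
Context {R : realType}.
Variables (c d : R).

(** exp(-1 / ((s - c) (d - s))) inside ]c, d[ and 0 outside. *)
Definition bump : R -> R := flat (('X - c%:P) * (d%:P - 'X)) 1 0.

Lemma bumpE s : bump s =
  if 0 < (s - c) * (d - s) then expR (- ((s - c) * (d - s))^-1) else 0.
Proof. by rewrite /bump /flat !hornerE expr0 invr1 !mul1r. Qed.

Lemma bump_gt0 s : c < s < d -> 0 < bump s.
Proof.
by move=> /andP[cs sd]; rewrite bumpE mulr_gt0 ?subr_gt0// expR_gt0.
Qed.

Lemma bump_ge0 s : 0 <= bump s.
Proof. by rewrite bumpE; case: ifP => // _; exact: expR_ge0. Qed.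

Lemma bump_out s : c < d -> (s <= c) || (d <= s) -> bump s = 0.
Proof.
move=> cd h; rewrite bumpE ltNge ifF//; apply/negbF.
case/orP: h => h.
- by rewrite mulr_le0_ge0 ?subr_le0 ?subr_ge0// (le_trans h) ?ltW.
- by rewrite mulr_ge0_le0 ?subr_le0 ?subr_ge0// (le_trans _ h) ?ltW.
Qed.

Lemma derivable_bump k s : derivable (bump^`(k))%classic s 1.
Proof.
have [q [m ->]] := derive1n_flat (('X - c%:P) * (d%:P - 'X)) 1 0 k.
by apply: ex_derive; exact: is_derive_flat.
Qed.

Lemma continuous_bump : continuous bump.
Proof.
move=> s; apply: differentiable_continuous; apply/derivable1_diffP.
exact: (@derivable_bump 0%N s).
Qed.

Hypothesis cd : c < d.

Lemma integrable_bump (A : set R) : measurable A ->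
  (@lebesgue_measure R).-integrable A (EFin \o bump).
Proof.
move=> mA; apply: (@integrableS _ _ _ _ setT) => //.
have : (@lebesgue_measure R).-integrable `[c, d] (EFin \o bump).
  apply: continuous_compact_integrable; first exact: segment_compact.
  exact/continuous_subspaceT/continuous_bump.
move=> /integrable_mkcond -/(_ (measurable_itv _)).
apply: eq_integrable => // x _; rewrite patchE /=.
case: ifPn => //; rewrite notin_setE/= in_itv/= => xcd.
rewrite bump_out//; apply: contra_notT xcd; rewrite negb_or -!ltNge.
by move=> /andP[cx xd]; rewrite !ltW.
Qed.

(** The normalised primitive of the bump on ]c, d[. *)
Lemma smooth_step_exists : exists B, smooth_step c d B.
Proof.
pose A (s : R) : R := \int[@lebesgue_measure R]_(t in `]-oo, s]) bump t.
have dA (s : R) : is_derive s 1 A (bump s).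
  have [] := @continuous_FTC1 R bump -oo%O s (s + 1) _ _ _ _.
  - by rewrite ltrDl.
  - exact: integrable_bump.
  - by rewrite ltNyr.
  - exact: continuous_bump.
  - by move=> dA dAE; apply: DeriveDef => //; rewrite -derive1E.
have A0 s : s <= c -> A s = 0.
  move=> sc; rewrite /A (@eq_Rintegral _ _ _ _ _ (cst 0)).
    by rewrite Rintegral_cst// mul0r.
  move=> t; rewrite inE/= in_itv/= => ts.
  by rewrite bump_out// (le_trans ts sc).
have cA (i : interval R) : {within [set` i], continuous A}.
  by apply: derivable_within_continuous => x _; exact: ex_derive.
have Ad0 : 0 < A d.
  have [x xcd] := @MVT R A bump c d cd (fun x _ => dA x) (cA _).
  rewrite (A0 c)// subr0 => ->; rewrite mulr_gt0 ?subr_gt0// bump_gt0//.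
have Ad s : d <= s -> A s = A d.
  move=> ds; have [x] := @MVT_segment R A bump d s ds (fun x _ => dA x) (cA _).
  rewrite in_itv/= => /andP[dx _].
  by rewrite bump_out ?dx ?orbT// mul0r => /eqP; rewrite subr_eq0 => /eqP.
have dB (s : R) : is_derive s 1 ((A d)^-1 *: A) ((A d)^-1 * bump s).
  exact: is_deriveZ.
have dBE : ((A d)^-1 *: A)^`()%classic = (A d)^-1 *: bump.
  by apply/funext => s; rewrite derive1E derive_val.
have dkB k : (((A d)^-1 *: bump)^`(k))%classic = (A d)^-1 *: (bump^`(k))%classic.
  elim: k => [//|k IH]; rewrite !derive1nS IH; apply/funext => s.
  by rewrite derive1E deriveZ ?fctE ?derive1E//; exact: derivable_bump.
exists ((A d)^-1 *: A); split.
- case=> [|k] s; first exact: ex_derive.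
  by rewrite derive1Sn dBE dkB; apply: derivableZ; exact: derivable_bump.
- by move=> s; rewrite dBE mulr_ge0 ?bump_ge0// invr_ge0 ltW.
- by move=> s h; rewrite dBE /= fctE bump_out// scaler0.
- by move=> s /A0 h; rewrite fctE h scaler0.
- by move=> s /Ad h; rewrite fctE h /GRing.scale/= mulVf// gt_eqF.
Qed.
End bump.

Section step_theory.
Context {R : realType}.
Variables (c d : R) (B : R -> R).
Hypothesis hB : smooth_step c d B.

Lemma is_derive_step (s : R) : is_derive s 1 B ((B^`())%classic s).
Proof.
have := step_derivable hB 0%N s; rewrite derive1n0 => h.
by apply: DeriveDef => //; rewrite derive1E.
Qed.

Lemma continuous_step (i : interval R) : {within [set` i], continuous B}.
Proof.
by apply: derivable_within_continuous => x _; exact: (step_derivable hB 0%N x).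
Qed.

Lemma continuous_step_deriv : continuous (B^`())%classic.
Proof.
move=> s; apply: differentiable_continuous; apply/derivable1_diffP.
exact: (step_derivable hB 1%N s).
Qed.

Lemma step_nondecreasing s t : s <= t -> B s <= B t.
Proof.
move=> st; have [x _ h] := MVT_segment st (fun x _ => is_derive_step x)
  (@continuous_step `[s, t]).
by rewrite -subr_ge0 h mulr_ge0 ?subr_ge0// (step_deriv_ge0 hB).
Qed.

Lemma step_ge0 s : 0 <= B s.
Proof.
have <- : B (Num.min c s) = 0 by apply: (step0 hB); rewrite ge_min lexx.
by apply: step_nondecreasing; rewrite ge_min lexx orbT.
Qed.

Lemma step_le1 s : B s <= 1.
Proof.
have <- : B (Num.max d s) = 1 by apply: (step1 hB); rewrite le_max lexx.
by apply: step_nondecreasing; rewrite le_max lexx orbT.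
Qed.

Lemma Rintegral_step_deriv l r : l < r -> l <= c -> d <= r ->
  \int[@lebesgue_measure R]_(s in `]l, r[) (B^`())%classic s = 1.
Proof.
move=> lr lc dr.
have ci : {within `[l, r], continuous (B^`())%classic}.
  exact/continuous_subspaceT/continuous_step_deriv.
have ii := continuous_compact_integrable (@segment_compact _ l r) ci.
rewrite Rintegral_itv_bndo_bndc; last first.
  by apply: integrableS ii => //; exact: subset_itv_oo_cc.
rewrite Rintegral_itv_obnd_cbnd; last first.
  by apply: integrableS ii => //; exact: subset_itv_oc_cc.
rewrite /Rintegral (@continuous_FTC2 _ _ B)//=.
  by rewrite (step1 hB dr) (step0 hB lc) subr0.
have cB (s : R) : {for s, continuous B}.
  apply: differentiable_continuous; apply/derivable1_diffP.
  exact: (step_derivable hB 0%N s).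
split.
- by move=> x _; exact: (step_derivable hB 0%N x).
- by apply: cvg_at_right_filter; exact: cB.
- by apply: cvg_at_left_filter; exact: cB.
Qed.

Lemma integrableM_step_deriv l r (f : R -> R) :
  {within `[l, r], continuous f} ->
  (@lebesgue_measure R).-integrable `]l, r[
    (EFin \o (fun s => f s * (B^`())%classic s)).
Proof.
move=> cf; have ci : {within `[l, r], continuous (fun s => f s * (B^`())%classic s)}.
  move=> s; apply: cvgM; first exact: cf.
  exact/continuous_subspaceT/continuous_step_deriv.
have ii := continuous_compact_integrable (@segment_compact _ l r) ci.
by apply: integrableS ii => //; exact: subset_itv_oo_cc.
Qed.

(** An average of f for a density carried by [c, d] stays within the
    oscillation of f on ]c, d[. *)
Lemma step_average l r (f : R -> R) (y e : R) : l < r -> l <= c -> d <= r ->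
  {within `[l, r], continuous f} ->
  (forall s, c < s < d -> `|f s - y| <= e) ->
  `|\int[@lebesgue_measure R]_(s in `]l, r[) (f s * (B^`())%classic s) - y| <= e.
Proof.
move=> lr lc dr cf fe.
have i1 := integrableM_step_deriv cf.
have ik (k : R) : (@lebesgue_measure R).-integrable `]l, r[
    (EFin \o (fun s => k * (B^`())%classic s)).
  by apply: (@integrableM_step_deriv l r (cst k)) => s; exact: cvg_cst.
have Ik (k : R) :
    \int[@lebesgue_measure R]_(s in `]l, r[) (k * (B^`())%classic s) = k.
  rewrite RintegralZl ?Rintegral_step_deriv ?mulr1//.
  have := ik 1; congr (_.-integrable _ _).
  by apply/funext => s /=; rewrite mul1r.
rewrite -[y in _ - y]Ik -RintegralB//.
have iB : (@lebesgue_measure R).-integrable `]l, r[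
    (EFin \o (fun s => f s * (B^`())%classic s - y * (B^`())%classic s)).
  by apply: (integrableB _ i1 (ik y)).
apply: (le_trans (le_normr_Rintegral _ _)) => //.
rewrite -[leRHS]Ik; apply: le_Rintegral => //.
  exact: integrable_norm iB.
move=> s _; rewrite -mulrBl normrM.
rewrite [`|_^`()%classic s|]ger0_norm ?(step_deriv_ge0 hB)//.
have [h|] := boolP ((s <= c) || (d <= s)).
  by rewrite (step_deriv_out hB h) !mulr0.
rewrite negb_or -!ltNge => h.
by rewrite ler_wpM2r ?(step_deriv_ge0 hB)// fe.
Qed.
End step_theory.

Lemma step_average_cvg (R : realType) (l r y : R) (f : R -> R)
    (B : nat -> R -> R) (c e d : nat -> R) : l < r -> y \in `[l, r] ->
  {within `[l, r], continuous f} -> d m @[m --> \oo] --> (0 : R) ->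
  (forall m, [/\ l <= c m, e m <= r & smooth_step (c m) (e m) (B m)]) ->
  (forall m s, c m < s < e m -> `|y - s| <= 2 * d m) ->
  \int[@lebesgue_measure R]_(s in `]l, r[) (f s * ((B m)^`())%classic s)
    @[m --> \oo] --> f y.
Proof.
move=> lr ylr cf dcvg hB hy; apply/cvgrPdist_le => /= eps eps0.
have /subspace_continuousP/(_ y ylr)/cvgrPdist_le/(_ _ eps0) := cf.
rewrite /= near_withinE => /nbhs_ballP[rho /= rho0 hrho].
have rho20 : 0 < rho / 2 by rewrite divr_gt0.
near=> m; have dm : d m < rho / 2 by near: m; exact: (cvgr_lt _ dcvg).
have [lcm erm hBm] := hB m.
rewrite distrC; apply: (step_average hBm) => // s scd.
rewrite distrC; apply: hrho => /=.
  by rewrite /ball/= (le_lt_trans (hy _ _ scd))//; move: dm; lra.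
by move: scd => /andP[? ?]; rewrite in_itv/=; lra.
Unshelve. all: by end_near. Qed.

(** * The fundamental theorem of calculus for an L2 weak derivative *)

Section cutoff.
Context {R : realType}.
(* B1 \- B2 is a smooth cutoff: 0 outside [a + d, b - d] and 1 on
   [a + 2 d, b - 2 d]. *)
Variables (a b d : R) (B1 B2 : R -> R).
Hypotheses (d0 : 0 < d) (dab : 4 * d <= b - a).
Hypotheses (hB1 : smooth_step (a + d) (a + 2 * d) B1).
Hypotheses (hB2 : smooth_step (b - 2 * d) (b - d) B2).

Lemma cutoff_deriv :
  ((B1 \- B2)^`())%classic = (B1^`())%classic \- (B2^`())%classic.
Proof.
apply/funext => s; rewrite derive1E deriveB /= ?derive1E//.
- exact: (step_derivable hB1 0%N s).
- exact: (step_derivable hB2 0%N s).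
Qed.

Lemma cutoff_out s : (s <= a + d) || (b - d <= s) -> B1 s - B2 s = 0.
Proof.
case/orP => h.
- by rewrite (step0 hB1 h) (step0 hB2) ?subrr//; move: d0 dab h; lra.
- by rewrite (step1 hB2 h) (step1 hB1) ?subrr//; move: d0 dab h; lra.
Qed.

Lemma cutoff_in s : a + 2 * d <= s <= b - 2 * d -> B1 s - B2 s = 1.
Proof. by move=> /andP[h1 h2]; rewrite (step1 hB1 h1) (step0 hB2 h2) subr0. Qed.

Lemma cutoff_norm_le1 s : `|B1 s - B2 s| <= 1.
Proof.
have := step_ge0 hB1 s; have := step_ge0 hB2 s.
have := step_le1 hB1 s; have := step_le1 hB2 s.
by move=> *; rewrite ler_norml; apply/andP; split; lra.
Qed.

(** Since d > 0, the support stays inside ]l, r[ even if a = l or b = r; this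
    is what later lets the endpoints of [l, r] be reached. *)
Lemma test_function_cutoff l r : l <= a -> b <= r -> test_function l r (B1 \- B2).
Proof.
move=> la br.
have sub : closure [set s | (B1 \- B2) s != 0] `<=` `[a + d, b - d].
  rewrite [X in _ `<=` X](closure_id _).1; last exact: interval_closed.
  apply: closureS => s /=; apply: contraNT.
  rewrite in_itv/= negb_and -!ltNge => h; apply/eqP/cutoff_out.
  by case/orP: h => h; rewrite (ltW h) ?orbT.
split.
- move=> k s.
  have -> : ((B1 \- B2)^`(k))%classic =
      (B1^`(k))%classic \- (B2^`(k))%classic.
    elim: k => [//|k IH]; rewrite derive1nS IH; apply/funext => t.
    rewrite derive1E deriveB /= ?derive1nS ?derive1E//.
    - exact: (step_derivable hB1 k t).
    - exact: (step_derivable hB2 k t).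
  apply: derivableB.
  - exact: (step_derivable hB1 k s).
  - exact: (step_derivable hB2 k s).
- apply: (subclosed_compact _ (@segment_compact _ (a + d) (b - d))) => //.
  exact: closed_closure.
- by apply: (subset_trans sub); apply: subset_itv; rewrite bnd_simp; move: d0; lra.
Qed.
End cutoff.

Section weak_FTC.
Context {R : realType}.
Local Notation mu := (@lebesgue_measure R).

(** On a bounded interval, |g| <= 1 + g^2. *)
Lemma square_integrable_integrable (l r : R) (g : R -> R) :
  square_integrable l r g -> mu.-integrable `]l, r[ (EFin \o g).
Proof.
move=> [mg ig].
have ib : mu.-integrable `]l, r[ (EFin \o (fun s => 1 + g s ^+ 2)).
  have i1 : mu.-integrable `]l, r[ (EFin \o cst (1 : R)).
    have ii := @continuous_compact_integrable R _ _ (@segment_compact _ l r)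
      (continuous_subspaceT (@cst_continuous _ _ (1 : R))).
    by apply: integrableS ii => //; exact: subset_itv_oo_cc.
  by apply: (integrableD _ i1 ig).
apply: le_integrable ib => //; first exact/measurable_EFinP.
move=> s _ /=; rewrite lee_fin [leRHS]ger0_norm ?addr_ge0 ?sqr_ge0//.
have := sqr_ge0 (`|g s| - 1); rewrite sqrrB1 -normrX (ger0_norm (sqr_ge0 _)) => h.
have := normr_ge0 (g s); rewrite mulr2n in h; lra.
Qed.

(** Test the weak derivative against cutoffs phi_m that converge to the indicator
    of ]a, b[. The integral of g phi_m tends to that of g on ]a, b[ by dominated
    convergence; phi_m' is a density concentrating at a minus one concentrating
    at b, so that the integral of f phi_m' tends to f a - f b. *)
Lemma weak_deriv_FTC (l r a b : R) (f g : R -> R) :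
  l <= a -> a < b -> b <= r -> {within `[l, r], continuous f} ->
  L2_weak_derivative l r f g ->
  \int[mu]_(s in `]a, b[) g s = f b - f a.
Proof.
move=> la ab br cf [/square_integrable_integrable ig hfg].
have lr : l < r by rewrite (le_lt_trans la)// (lt_le_trans ab).
(* The two transition layers of width 2 d m have to be disjoint in [a, b]. *)
pose d m : R := (b - a) / 4 / m.+1%:R.
have d0 m : 0 < d m by rewrite !divr_gt0 ?subr_gt0.
have dab m : 4 * d m <= b - a.
  rewrite /d mulrA mulrCA divff// mulr1 ler_pdivrMr// ler_peMr ?ler1n//.
  by rewrite subr_ge0 ltW.
have dcvg : d m @[m --> \oo] --> (0 : R).
  rewrite -[X in _ --> X](mulr0 ((b - a) / 4)); apply: cvgMl_tmp; exact: cvg_harmonic.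
have /choice[B1 hB1] m : exists B, smooth_step (a + d m) (a + 2 * d m) B.
  by apply: smooth_step_exists; have := d0 m; lra.
have /choice[B2 hB2] m : exists B, smooth_step (b - 2 * d m) (b - d m) B.
  by apply: smooth_step_exists; have := d0 m; lra.
pose phi m := B1 m \- B2 m.
have tphi m : test_function l r (phi m).
  by apply: (test_function_cutoff _ _ (hB1 m) (hB2 m)).
have E1 m : \int[mu]_(s in `]l, r[) (f s * ((phi m)^`())%classic s) =
    \int[mu]_(s in `]l, r[) (f s * ((B1 m)^`())%classic s) -
    \int[mu]_(s in `]l, r[) (f s * ((B2 m)^`())%classic s).
  rewrite -RintegralB//.
  - apply: eq_Rintegral => s _.
    by rewrite (cutoff_deriv (hB1 m) (hB2 m)) /= mulrBr.
  - exact: (integrableM_step_deriv (hB1 m)).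
  - exact: (integrableM_step_deriv (hB2 m)).
have lim1 : \int[mu]_(s in `]l, r[) (f s * ((phi m)^`())%classic s) @[m --> \oo]
    --> f a - f b.
  under eq_cvg do rewrite E1.
  apply: cvgB.
  - apply: (step_average_cvg (c := fun m => a + d m)
      (e := fun m => a + 2 * d m) lr _ cf dcvg).
    + by rewrite in_itv/= la ltW// (lt_le_trans ab).
    + by move=> m; split => //; move: (d0 m) (dab m); lra.
    + move=> m s /andP[s1 s2]; have dm0 := d0 m.
      by rewrite ler_norml; apply/andP; split; lra.
  - apply: (step_average_cvg (c := fun m => b - 2 * d m)
      (e := fun m => b - d m) lr _ cf dcvg).
    + by rewrite in_itv/= br andbT ltW// (le_lt_trans la).
    + by move=> m; split => //; move: (d0 m) (dab m); lra.
    + move=> m s /andP[s1 s2]; have dm0 := d0 m.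
      by rewrite ler_norml; apply/andP; split; lra.
have mg : measurable_fun `]l, r[ g by case/integrableP : ig => /measurable_EFinP.
have mphi m : measurable_fun setT (phi m).
  apply: continuous_measurable_fun => s.
  apply: differentiable_continuous; apply/derivable1_diffP.
  by case: (tphi m) => /(_ 0%N s).
have mgphi m : measurable_fun `]l, r[ (fun s => (g s * phi m s)%:E).
  apply/measurable_EFinP; apply: measurable_funM => //.
  exact: measurable_funTS.
have mgi : measurable_fun `]l, r[ (fun s => (g s * \1_`]a, b[%classic s)%:E).
  by apply/measurable_EFinP; apply: measurable_funM => //; exact: measurable_indic.
have ptw s : (g s * phi m s)%:E @[m --> \oo] --> (g s * \1_`]a, b[%classic s)%:E.
  apply: cvg_EFin; first exact: nearW.
  apply: cvgMl_tmp.
  rewrite indicE; case: (boolP (s \in `]a, b[%classic)) => [|];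
    rewrite ?inE ?notin_setE/= in_itv/=.
    move=> /andP[as_ sb].
    apply: (@cvg_near_cst).
    have h1 : 0 < (s - a) / 2 by lra.
    have h2 : 0 < (b - s) / 2 by lra.
    near=> m; apply: (cutoff_in (hB1 m) (hB2 m)).
    have : d m < (s - a) / 2 by near: m; exact: (cvgr_lt _ dcvg).
    have : d m < (b - s) / 2 by near: m; exact: (cvgr_lt _ dcvg).
    lra.
  move=> sab; apply: cvg_near_cst; apply: nearW => m.
  apply: (cutoff_out (d0 m) (dab m) (hB1 m) (hB2 m)).
  by move: sab (d0 m) => /negP; rewrite negb_and -!leNgt; lra.
have dom m s : (`|(g s * phi m s)%:E| <= `|g s|%:E)%E.
  rewrite lee_fin normrM ler_piMr//.
  exact: (cutoff_norm_le1 (hB1 m) (hB2 m)).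
have ae1 : {ae mu, forall s, `]l, r[%classic s ->
    (g s * phi m s)%:E @[m --> \oo] --> (g s * \1_`]a, b[%classic s)%:E}.
  by apply: aeW => s _; exact: ptw.
have ae2 : {ae mu, forall s (m : nat), `]l, r[%classic s ->
    (`|(g s * phi m s)%:E| <= `|g s|%:E)%E}.
  by apply: aeW => s m _; exact: dom.
have [igi _] := @dominated_convergence _ _ R mu `]l, r[%classic
  (measurable_itv _) _ _ _ mgphi mgi ae1 (integrable_norm ig) ae2.
rewrite -(fineK (integrable_fin_num _ igi))// => /fine_cvg lim2.
have -> : \int[mu]_(s in `]a, b[) g s =
    fine (\int[mu]_(s in `]l, r[) (g s * \1_`]a, b[%classic s)%:E).
  have -> : `]a, b[%classic = `]l, r[%classic `&` `]a, b[%classic.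
    by rewrite setIidr//; apply: subset_itv; rewrite bnd_simp.
  rewrite Rintegral_mkcondr; apply: eq_Rintegral => s _.
  rewrite patchE indicE in_setI.
  have [sab|] := boolP (s \in `]a, b[%classic); last by rewrite andbF mulr0.
  rewrite andbT mem_set ?mulr1//=.
  move: sab; rewrite inE; apply: subset_itv; rewrite bnd_simp//.
have lim3 : fine (\int[mu]_(s in `]l, r[) (g s * phi m s)%:E) @[m --> \oo] -->
    - (f a - f b).
  under eq_cvg => m.
    rewrite -[fine _]opprK -(hfg _ (tphi m)).
    over.
  exact: cvgN.
rewrite -opprB; exact: (cvg_unique _ lim2 lim3).
Unshelve. all: by end_near.
Qed.
End weak_FTC.

(** * Integrals against a nondecreasing kernel *)

Section monotone_kernel.
Context {R : realType}.
Local Notation mu := (@lebesgue_measure R).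
Variables (a b : R) (k g : R -> R).
Hypotheses (ab : a < b) (k_ge0 : 0 <= k a).
Hypothesis k_nd : forall s t, a <= s -> s <= t -> t < b -> k s <= k t.
Hypothesis k_cont : forall s, a <= s < b -> {for s, continuous k}.
Hypothesis ig : mu.-integrable `[a, b[ (EFin \o g).
Hypothesis ikg : mu.-integrable `[a, b[ (EFin \o (fun s => k s * g s)).
Hypothesis tail_ge0 : forall c, a <= c < b -> 0 <= \int[mu]_(s in `[c, b[) g s.

(* stair m is the value of k at the last of the nodes a, a + mesh m, ... up to
   s, written as k a plus the jumps already passed. The nodes stay away from b,
   where k may blow up. *)
Let mesh m : R := (b - a) / m.+1%:R.
Let node m i : R := a + i%:R * mesh m.
Let stair m (s : R) : R :=
  k a + \sum_(0 <= i < m)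
    (k (node m i.+1) - k (node m i)) * \1_`[node m i.+1, +oo[%classic s.

Let mesh_gt0 m : 0 < mesh m. Proof. by rewrite divr_gt0 ?subr_gt0. Qed.

Let node_ge m i : a <= node m i.
Proof. by rewrite lerDl mulr_ge0// ltW. Qed.

Let node_lt m i : (i < m.+1)%N -> node m i < b.
Proof.
move=> im; rewrite -ltrBrDl /mesh mulrCA gtr_pMr ?subr_gt0//.
by rewrite ltr_pdivrMr// mul1r ltr_nat.
Qed.

Let node_le m i j : (i <= j)%N -> node m i <= node m j.
Proof. by move=> ij; rewrite lerD2l ler_pM2r// ler_nat. Qed.

Let rank m (s : R) := Num.truncn ((s - a) / mesh m).

Let rank_node m s i : a <= s -> (node m i <= s) = (i <= rank m s)%N.
Proof.
move=> as_; rewrite /rank truncn_ge_nat; last by rewrite divr_ge0 ?subr_ge0// ltW.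
by rewrite ler_pdivlMr// lerBrDl.
Qed.

Let rank_le m s : a <= s < b -> (rank m s <= m)%N.
Proof.
move=> /andP[as_ sb]; rewrite leqNgt -rank_node// -ltNge.
by rewrite /node /mesh mulrCA divff// mulr1 addrCA subrr addr0.
Qed.

Let stairE m s : a <= s < b -> stair m s = k (node m (rank m s)).
Proof.
move=> asb; have [as_ sb] := andP asb.
rewrite /stair (big_cat_nat (leq0n _) (rank_le m asb))/=.
rewrite [X in _ + (_ + X)]big1_seq ?addr0; last first.
  move=> i /=; rewrite mem_index_iota => /andP[ri _].
  by rewrite indicE memNset ?mulr0//= in_itv/= andbT rank_node// ltnNge ri.
rewrite (eq_big_nat _ _ (F2 := fun i => k (node m i.+1) - k (node m i))); last first.
  move=> i /andP[_ ri].
  by rewrite indicE mem_set ?mulr1//= in_itv/= andbT rank_node.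
rewrite telescope_sumr// /node mul0r addr0; ring.
Qed.

Let stair_bound m s : a <= s < b -> 0 <= stair m s <= k s.
Proof.
move=> asb; have [as_ sb] := andP asb; rewrite stairE//.
have h : node m (rank m s) <= s by rewrite rank_node.
rewrite k_nd ?andbT//.
by rewrite (le_trans k_ge0)// k_nd// (le_lt_trans h).
Qed.

Let stair_cvg s : a <= s < b -> stair m s @[m --> \oo] --> k s.
Proof.
move=> asb; have [as_ sb] := andP asb.
under eq_cvg do rewrite stairE//.
suff h : node m (rank m s) @[m --> \oo] --> s.
  exact: (continuous_cvg _ (k_cont asb) h).
have mesh0 : s - mesh m @[m --> \oo] --> s.
  rewrite -[X in _ --> X]subr0 -[X in _ --> _ - X](mulr0 (b - a)).
  apply: cvgB; first exact: cvg_cst.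
  by apply: cvgMl_tmp; exact: cvg_harmonic.
apply: squeeze_cvgr mesh0 (cvg_cst s); apply: nearW => m.
rewrite rank_node// leqnn andbT lerBlDr.
have : s < node m (rank m s).+1 by rewrite ltNge rank_node// ltnn.
by rewrite /node -natr1 mulrDl mul1r addrA => /ltW.
Qed.

(* Each jump contributes a nonnegative multiple of a tail integral of g. *)
Let stair_integral m :
  mu.-integrable `[a, b[ (EFin \o (fun s => stair m s * g s)) /\
  k a * \int[mu]_(s in `[a, b[) g s <= \int[mu]_(s in `[a, b[) (stair m s * g s).
Proof.
pose st j s := k a + \sum_(0 <= i < j)
  (k (node m i.+1) - k (node m i)) * \1_`[node m i.+1, +oo[%classic s.
suff H j : (j <= m)%N ->
  mu.-integrable `[a, b[ (EFin \o (fun s => st j s * g s)) /\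
  k a * \int[mu]_(s in `[a, b[) g s <= \int[mu]_(s in `[a, b[) (st j s * g s).
  exact: (H m).
elim: j => [_|j IH jm].
  have E : (fun s => st 0%N s * g s) = (fun s => k a * g s).
    by apply/funext => s; rewrite /st big_geq// addr0.
  rewrite E; split; last by rewrite RintegralZl.
  by apply: (integrableZl _ (k a) ig).
have [IH1 IH2] := IH (ltnW jm).
pose D := k (node m j.+1) - k (node m j).
have D0 : 0 <= D by rewrite subr_ge0 k_nd// ?node_le// node_lt.
pose e s := D * (\1_`[node m j.+1, +oo[%classic s * g s).
have i1 : mu.-integrable `[a, b[
    (EFin \o (fun s => \1_`[node m j.+1, +oo[%classic s * g s)).
  apply: le_integrable ig => //.
    apply/measurable_EFinP; apply: measurable_funM => //.
    by case/integrableP : ig => /measurable_EFinP.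
  move=> s _ /=; rewrite lee_fin normrM ler_piMl// indicE.
  by case: (_ \in _); rewrite ?normr1 ?normr0.
have ie : mu.-integrable `[a, b[ (EFin \o e) by apply: (integrableZl _ D i1).
have E : (fun s => st j.+1 s * g s) = (fun s => st j s * g s + e s).
  by apply/funext => s; rewrite /st big_nat_recr//= /e /D; ring.
rewrite E; split; first by apply: (integrableD _ IH1 ie).
rewrite RintegralD//; apply: (le_trans IH2); rewrite lerDl.
rewrite RintegralZl//; apply: mulr_ge0 => //.
have c1 := @node_lt m j.+1 jm.
have := @tail_ge0 (node m j.+1); rewrite node_ge c1 => /(_ isT).
have -> : `[node m j.+1, b[%classic =
    `[a, b[%classic `&` `[node m j.+1, +oo[%classic.
  apply/seteqP; split=> s /=; rewrite !in_itv/= andbT.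
  - by move=> /andP[h ->]; rewrite (le_trans (node_ge _ _) h).
  - by move=> [/andP[_ ->] ->].
rewrite Rintegral_mkcondr; congr (_ <= _); apply: eq_Rintegral => s _.
by rewrite patchE indicE; case: ifP; rewrite ?mul1r ?mul0r.
Qed.

(** Integration by parts without differentiating k: when every tail integral of
    g is nonnegative, so is the integral of g against k - k a, because k - k a is
    a superposition of indicators of final segments. It is approximated by the
    staircases above, and dominated convergence applies since the integrability
    of k g is assumed. *)
Lemma monotone_kernel_le :
  k a * \int[mu]_(s in `[a, b[) g s <= \int[mu]_(s in `[a, b[) (k s * g s).
Proof.
have ms m : measurable_fun `[a, b[ (fun s => (stair m s * g s)%:E).
  by have [/integrableP[]] := stair_integral m.
have mk : measurable_fun `[a, b[ (fun s => (k s * g s)%:E).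
  by have /integrableP[] := ikg.
have ae1 : {ae mu, forall s, `[a, b[%classic s ->
    (stair m s * g s)%:E @[m --> \oo] --> (k s * g s)%:E}.
  apply: aeW => s /=; rewrite in_itv/= => asb.
  apply: cvg_EFin; first exact: nearW.
  by apply: cvgMr_tmp; exact: stair_cvg.
have ae2 : {ae mu, forall s (m : nat), `[a, b[%classic s ->
    (`|(stair m s * g s)%:E| <= `|k s * g s|%:E)%E}.
  apply: aeW => s m /=; rewrite in_itv/= => asb.
  rewrite lee_fin !normrM ler_wpM2r//.
  have /andP[h1 h2] := stair_bound m asb.
  by rewrite !ger0_norm// (le_trans h1).
have [_ _] := @dominated_convergence _ _ R mu `[a, b[%classic
  (measurable_itv _) _ _ _ ms mk ae1 (integrable_norm ikg) ae2.
rewrite -(fineK (integrable_fin_num _ ikg))// => /fine_cvg lim.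
by apply: (cvgr_to_ge lim); apply: nearW => m; exact: (stair_integral m).2.
Qed.
End monotone_kernel.

(** * Positivity of Gamma on ]0, 1] *)

Section Gamma_gt0.
Context {R : realType}.
Local Notation mu := (@lebesgue_measure R).
Variable z : R.
Hypotheses (z0 : 0 < z) (z1 : z <= 1).

Let f (s : R) : R := s `^ (z - 1) * expR (- s).

Let f_ge0 s : 0 <= f s. Proof. by rewrite mulr_ge0 ?powR_ge0 ?expR_ge0. Qed.

Let mf (D : set R) : measurable_fun D (EFin \o f).
Proof.
apply/measurable_EFinP; apply: measurable_funTS; apply: measurable_funM.
  exact: measurable_powR.
by apply: measurableT_comp => //; exact: measurable_expR.
Qed.

Let mpow (D : set R) : measurable_fun D (EFin \o (fun s : R => s `^ (z - 1))).
Proof.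
by apply/measurable_EFinP; apply: measurable_funTS; exact: measurable_powR.
Qed.

Let mexpN (D : set R) : measurable_fun D (EFin \o (fun s : R => expR (- s))).
Proof.
apply/measurable_EFinP; apply: measurable_funTS.
by apply: measurableT_comp => //; exact: measurable_expR.
Qed.

(* s^(z-1) exp(-s) is below the derivative of s^z / z; the singularity at 0 is
   approached by monotone convergence along [1/(n+2), 1]. *)
Let integral_near0 : (\int[mu]_(s in `]0%R, 1%R]) (f s)%:E <= (z^-1)%:E)%E.
Proof.
pose I (n : nat) : set R := `[n.+2%:R^-1, 1]%classic.
have -> : `]0%R, 1%R]%classic = \bigcup_n I n.
  apply/seteqP; split => s /=; rewrite /I.
  - rewrite in_itv/= => /andP[s0 s1].
    exists (Num.truncn s^-1) => //=; rewrite in_itv/= s1 andbT.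
    rewrite -[leRHS]invrK lef_pV2 ?posrE ?invr_gt0//.
    apply: (@le_trans _ _ (Num.truncn s^-1).+1%:R); last by rewrite ler_nat.
    by apply/ltW/truncnS_gt.
  - move=> [n _] /=; rewrite !in_itv/= => /andP[h ->]; rewrite andbT.
    by rewrite (lt_le_trans _ h)// invr_gt0.
have ndI : nondecreasing_seq I.
  move=> m n mn; rewrite subsetEset; apply: subset_itvr; rewrite bnd_simp.
  by rewrite lef_pV2 ?posrE// ler_nat !ltnS.
have H := @ge0_nondecreasing_set_cvg_integral _ (measurableTypeR R) R I
  (EFin \o f) mu ndI (fun=> measurable_itv _) (fun i => @mf (I i)).
have {}H : (\int[mu]_(x in I i) (f x)%:E)%E @[i --> \oo] -->
    (\int[mu]_(x in \bigcup_i I i) (f x)%:E)%E.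
  by apply: H => i x; rewrite /= lee_fin.
apply: (cvge_to_le H); apply: nearW => n.
have n1 : n.+2%:R^-1 < 1 :> R by rewrite invf_lt1 ?ltr1n.
have n0 : 0 < n.+2%:R^-1 :> R by rewrite invr_gt0.
have pwc (p s : R) : 0 < s -> {for s, continuous (fun x : R => x `^ p)}.
  move=> s0; apply: differentiable_continuous; apply/derivable1_diffP.
  by apply: derivable_powR; rewrite in_itv/= s0.
apply: (@le_trans _ _ (\int[mu]_(x in I n) (x `^ (z - 1))%:E)%E).
  apply: ge0_le_integral => //.
  - exact: measurable_itv.
  - by move=> x _; rewrite lee_fin.
  - exact: mf.
  - exact: mpow.
  - move=> x; rewrite /I/= in_itv/= => /andP[h _].
    rewrite lee_fin ler_piMr ?powR_ge0//.
    by rewrite -expR0 ler_expR oppr_le0 (le_trans _ h)// ltW.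
pose F s : R := z^-1 * s `^ z.
have dF (s : R) : 0 < s -> is_derive s 1 F (s `^ (z - 1)).
  move=> s0; have h := is_derive1_powR z s0.
  apply: (is_derive_eq (is_deriveZ z^-1 h)).
  by rewrite /GRing.scale/= mulrA mulVf ?mul1r// gt_eqF.
have cF s : 0 < s -> {for s, continuous F}.
  by move=> s0; apply: cvgMl_tmp; exact: pwc.
rewrite (@continuous_FTC2 _ _ F)//.
- rewrite -EFinB lee_fin /F powR1 mulr1 gerBl//.
  by rewrite mulr_ge0 ?powR_ge0// invr_ge0 ltW.
- apply: continuous_in_subspaceT => s; rewrite inE/= in_itv/= => /andP[h _].
  exact/pwc/(lt_le_trans n0).
- split.
  + move=> s; rewrite in_itv/= => /andP[h _].
    have hd := dF s (lt_trans n0 h); exact: ex_derive.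
  + by apply: cvg_at_right_filter; exact: cF.
  + by apply: cvg_at_left_filter; exact: cF.
- move=> s; rewrite in_itv/= => /andP[h _].
  have hd := dF s (lt_trans n0 h); rewrite derive1E; exact: derive_val.
Qed.

Let integral_near_infty :
  (\int[mu]_(s in `[1%R, +oo[) (f s)%:E <= (expR (- 1))%:E)%E.
Proof.
have cE : continuous (fun s : R => expR (- s)).
  move=> s; apply: continuous_comp; first exact: opp_continuous.
  exact: continuous_expR.
apply: (@le_trans _ _ (\int[mu]_(s in `[1%R, +oo[) (expR (- s))%:E)%E).
  apply: ge0_le_integral => //.
  - by move=> x _; rewrite lee_fin.
  - exact: mf.
  - exact: mexpN.
  - move=> x; rewrite /= in_itv/= andbT => h; rewrite lee_fin ler_piMl ?expR_ge0//.
    by rewrite -[leRHS](powRr0 x) ler_powR// subr_le0.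
have dE (s : R) : is_derive s 1 (fun s : R => - expR (- s)) (expR (- s)).
  have h := is_deriveN
    (is_derive1_comp (is_derive_expR (- s)) (is_deriveNid s 1)).
  by apply: (is_derive_eq h); rewrite mulrN1 opprK.
rewrite (@ge0_continuous_FTC2y _ _ (fun s => - expR (- s)) _ 0)//.
- by rewrite -EFinB sub0r opprK.
- exact: continuous_subspaceT.
- by rewrite -oppr0; apply: cvgN; exact: cvgr_expR.
- by apply: cvg_at_right_filter; apply: cvgN; exact: cE.
- by move=> s _; rewrite derive1E derive_val.
Qed.

(** The integral is finite, so that its real value is not the default 0, and the
    integrand is at least exp(-1) on [1/2, 1]. *)
Lemma Gamma_gt0 : 0 < Gamma z.
Proof.
rewrite /Gamma -/f; apply: fine_gt0; apply/andP; split; last first.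
  have -> : `]0%R, +oo[%classic =
      `]0%R, 1%R]%classic `|` `]1%R, +oo[%classic :> set R.
    by rewrite -itv_bndbnd_setU ?bnd_simp.
  rewrite ge0_integral_setU//; last 3 first.
  - exact: mf.
  - by move=> x _; rewrite /= lee_fin.
  - apply/disj_setPS => y [/=]; rewrite !in_itv/= => /andP[_ y1].
    by rewrite andbT ltNge y1.
  apply: (@le_lt_trans _ _ ((z^-1)%:E + (expR (- 1))%:E)%E); last by rewrite ltry.
  apply: leeD => //; rewrite integral_itv_obnd_cbnd//; exact: mf.
apply: (@lt_le_trans _ _ (\int[mu]_(s in `[2^-1%R, 1%R]) (expR (- 1))%:E)%E).
  rewrite integral_cst//= lebesgue_measure_itv/= lte_fin invf_lt1 ?ltr1n//.
  by rewrite -EFinD -EFinM lte_fin mulr_gt0 ?expR_gt0//; lra.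
apply: (@le_trans _ _ (\int[mu]_(s in `[2^-1%R, 1%R]) (f s)%:E)%E).
  apply: ge0_le_integral => //.
  - exact: mf.
  - move=> x; rewrite /= in_itv/= => /andP[h1 h2].
    have x0 : 0 < x by apply: lt_le_trans h1.
    rewrite lee_fin /f -[leLHS]mul1r ler_pM ?expR_ge0//.
    + by rewrite -[leLHS](powRr0 x) ger_powR ?x0// subr_le0.
    + by rewrite ler_expR lerN2.
apply: ge0_subset_integral => //.
- exact: mf.
- by move=> x _; rewrite /= lee_fin.
- by apply: subset_itv; rewrite bnd_simp.
Qed.
End Gamma_gt0.

(** * The Laplacian at an interior maximum *)

Section second_derivative_test.
Context {R : realType}.

(** At the maximum q = p' vanishes; were q'(0) > 0, q would be positive just to
    the right of 0 and the mean value theorem would make p exceed p 0 there. *)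
Lemma second_derivative_at_max (p q : R -> R) (r : R) : 0 < r ->
  (forall h : R, `|h| < r -> is_derive h 1 p (q h)) ->
  derivable q 0 1 -> (forall h, `|h| < r -> p h <= p 0) -> 'D_1 q 0 <= 0.
Proof.
move=> r0 dp dq pmax.
have inr h : h \in `]- r, r[ -> `|h| < r by rewrite in_itv/= ltr_norml.
have q00 : q 0 = 0.
  have d0 := dp 0; rewrite normr0 in d0.
  have [_ <-] := d0 r0.
  suff [_ ->//] : is_derive (0 : R) 1 p 0.
  apply: (@derive1_at_max _ p (- r) r 0).
  - by rewrite ge0_cp ?ltW.
  - by move=> h /inr/dp hd; exact: ex_derive.
  - by rewrite in_itv/= oppr_lt0 r0.
  - by move=> h /inr; exact: pmax.
rewrite leNgt; apply/negP => L0.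
have : h^-1 *: (q h - q 0) @[h --> 0^'] --> 'D_1 q 0.
  have := dq; rewrite /derivable => /cvg_ex[l hl].
  have -> : 'D_1 q 0 = l by apply: cvg_lim.
  apply: cvg_trans hl; apply: near_eq_cvg; near=> h.
  by rewrite /= addr0 [_%:A]mulr1.
move=> /cvgr_gt/(_ _ L0); rewrite near_withinE => /nbhs_ballP[e /= e0 he].
have qpos h : 0 < h -> h < e -> 0 < q h.
  move=> h0 hlt; have := he h; rewrite /ball/= sub0r normrN gtr0_norm// => /(_ hlt).
  rewrite q00 subr0 gt_eqF// => /(_ isT).
  by rewrite /GRing.scale/= pmulr_rgt0// invr_gt0.
pose h0 := Num.min (r / 2) (e / 2).
have h0_gt0 : 0 < h0 by rewrite lt_min !divr_gt0.
have h0r : h0 < r by rewrite gt_min; apply/orP; left; lra.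
have h0e : h0 < e by rewrite gt_min; apply/orP; right; lra.
have inh h : 0 <= h <= h0 -> `|h| < r.
  by move=> /andP[h1 h2]; rewrite ger0_norm// (le_lt_trans h2).
have [||c] := @MVT _ p q 0 h0 h0_gt0.
- by move=> h; rewrite in_itv/= => /andP[h1 h2]; apply: dp; apply: inh; rewrite !ltW.
- apply: derivable_within_continuous => h; rewrite in_itv/= => /inh/dp hd.
  exact: ex_derive.
rewrite in_itv/= => /andP[c0 ch].
have := pmax h0; rewrite gtr0_norm// => /(_ h0r).
rewrite -subr_le0 => + E; rewrite E leNgt => /negP; apply.
by rewrite subr0 mulr_gt0// qpos// (lt_trans ch).
Unshelve. all: by end_near. Qed.

Variable n : nat.
Implicit Types (u : 'rV[R]_n -> R) (x : 'rV[R]_n) (G : set 'rV[R]_n).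

Lemma is_derive_line u x (v : 'rV[R]_n) (h : R) : derivable u (x + h *: v) v ->
  is_derive h 1 (fun t : R => u (x + t *: v)) ('D_v u (x + h *: v)).
Proof.
move=> du.
have E : (fun s : R => s^-1 *: (((fun t : R => u (x + t *: v)) \o shift h)
        (s *: 1) - u (x + h *: v))) =
    (fun s : R => s^-1 *: ((u \o shift (x + h *: v)) (s *: v) -
        u (x + h *: v))).
  apply/funext => s /=; congr (_ *: (u _ - _)).
  by rewrite [s%:A]mulr1 scalerDl addrCA.
by apply: DeriveDef; rewrite /derivable /derive E.
Qed.

Lemma second_partial_le_at_max G u1 u2 x (j : 'I_n) : open G -> G x ->
  class_C 2 G u1 -> class_C 2 G u2 ->
  (forall y, G y -> u1 y - u2 y <= u1 x - u2 x) ->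
  partial j (partial j u1) x <= partial j (partial j u2) x.
Proof.
move=> oG Gx [_ /(_ j)[d1 [_ /(_ j)[dd1 _]]]].
move=> [_ /(_ j)[d2 [_ /(_ j)[dd2 _]]]] umax.
pose v : 'rV[R]_n := delta_mx 0 j.
have lineG : \forall h \near (0 : R), G (x + h *: v).
  have : x + h *: v @[h --> (0 : R)] --> x.
    rewrite -[X in _ --> X]addr0 -(scale0r v).
    by apply: cvgD; [exact: cvg_cst|apply: cvgZr_tmp; exact: cvg_id].
  by apply; apply: open_nbhs_nbhs.
have /nbhs_ballP[r /= r0 hr] := lineG.
have {}hr (h : R) : `|h| < r -> G (x + h *: v).
  by move=> hlt; apply: hr; rewrite /ball/= sub0r normrN.
have x0 : x + 0 *: v = x by rewrite scale0r addr0.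
have dline u : (forall y, G y -> derivable u y v) ->
    forall h : R, `|h| < r ->
    is_derive h 1 (fun t : R => u (x + t *: v)) ('D_v u (x + h *: v)).
  by move=> du h /hr Gh; apply: is_derive_line; exact: du.
have n0 : `|0 : R| < r by rewrite normr0.
have D1 := dline _ dd1 0 n0; have D2 := dline _ dd2 0 n0.
have := @second_derivative_at_max
  (fun h => u1 (x + h *: v) - u2 (x + h *: v))
  (fun h => partial j u1 (x + h *: v) - partial j u2 (x + h *: v)) r r0 _ _ _.
have DB := is_deriveB D1 D2; rewrite x0 in DB.
rewrite (@derive_val _ _ _ _ _ _ _ DB) subr_le0; apply.
- by move=> h hlt; have := is_deriveB (dline _ d1 h hlt) (dline _ d2 h hlt).
- exact: (@ex_derive _ _ _ _ _ _ _ DB).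
- by move=> h /hr Gh; rewrite x0; exact: umax.
Qed.

Lemma laplacian_le_at_max G u1 u2 x : open G -> G x ->
  class_C 2 G u1 -> class_C 2 G u2 ->
  (forall y, G y -> u1 y - u2 y <= u1 x - u2 x) ->
  laplacian u1 x <= laplacian u2 x.
Proof.
move=> oG Gx C1 C2 umax; apply: ler_sum => j _.
exact: (second_partial_le_at_max j oG Gx C1 C2 umax).
Qed.
End second_derivative_test.

(** * The extremum principle for the Hadamard derivative *)

Lemma integrable_itvS (R : realType) (i j : interval R) (f : R -> \bar R) :
  [set` j] `<=` [set` i] -> (@lebesgue_measure R).-integrable [set` i] f ->
  (@lebesgue_measure R).-integrable [set` j] f.
Proof. by move=> ji fi; apply: integrableS fi. Qed.

Section hadamard_extremum.
Context {R : realType}.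
Local Notation mu := (@lebesgue_measure R).
Variables (alpha T t : R).
Hypotheses (alpha01 : 0 < alpha < 1) (t1 : 1 < t) (tT : t <= T).

Let ln_ratio_gt0 s : 1 <= s < t -> 0 < ln (t / s).
Proof.
move=> /andP[s1 st]; rewrite ln_gt0// ltr_pdivlMr ?mul1r//.
exact: lt_le_trans s1.
Qed.

Lemma hadamard_kernel_nondecreasing s s' : 1 <= s -> s <= s' -> s' < t ->
  ln (t / s) `^ (- alpha) <= ln (t / s') `^ (- alpha).
Proof.
move=> s1 ss' s't; have [a0 _] := andP alpha01.
have s0 : 0 < s by apply: lt_le_trans s1.
have s'0 : 0 < s' by apply: lt_le_trans ss'.
have t0 : 0 < t by apply: lt_trans s't.
have l0 : 0 < ln (t / s) by rewrite ln_ratio_gt0// s1 (le_lt_trans ss').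
have l'0 : 0 < ln (t / s') by rewrite ln_ratio_gt0// s't (le_trans s1).
rewrite !powRN lef_pV2 ?posrE ?powR_gt0//.
apply: ge0_ler_powR; rewrite ?nnegrE; try exact: ltW.
by rewrite ler_ln ?posrE ?divr_gt0// ler_pM2l// lef_pV2.
Qed.

Lemma hadamard_kernel_continuous s : 1 <= s < t ->
  {for s, continuous (fun s : R => ln (t / s) `^ (- alpha))}.
Proof.
move=> st; have l0 := ln_ratio_gt0 st; have [s1 s2] := andP st.
have s0 : 0 < s by apply: lt_le_trans s1.
have c1 : {for s, continuous (fun s : R => t / s)}.
  by apply: cvgMl_tmp; apply: cvgV; [rewrite gt_eqF|exact: cvg_id].
have c2 : {for s, continuous (fun s : R => ln (t / s))}.
  apply: continuous_comp c1 _; apply: continuous_ln.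
  by rewrite divr_gt0// (lt_trans s0).
apply: (continuous_comp c2 (g := fun x : R => x `^ (- alpha))).
apply: differentiable_continuous; apply/derivable1_diffP.
by apply: derivable_powR; rewrite in_itv/= andbT.
Qed.

Variables f1 f2 : R -> R.
Hypotheses (cf1 : {within `[1, T], continuous f1}).
Hypotheses (cf2 : {within `[1, T], continuous f2}).
Hypotheses (wf1 : W12 1 T f1) (wf2 : W12 1 T f2).
Hypothesis if1 : mu.-integrable `[1, t]
  (fun s => (hadamard_integrand T alpha f1 t s)%:E).
Hypothesis if2 : mu.-integrable `[1, t]
  (fun s => (hadamard_integrand T alpha f2 t s)%:E).
Hypothesis fmax : forall s, 1 <= s <= t -> f1 s - f2 s <= f1 t - f2 t.

Let g1 := weak_deriv 1 T f1.
Let g2 := weak_deriv 1 T f2.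

Let weak_derivP f : W12 1 T f -> L2_weak_derivative 1 T f (weak_deriv 1 T f).
Proof. by move=> [_ hf]; exact: (xgetPex (cst 0) hf). Qed.

Let integrable_weak_deriv f : W12 1 T f ->
  mu.-integrable `[1, t[ (EFin \o weak_deriv 1 T f).
Proof.
move=> /weak_derivP[/square_integrable_integrable ig _].
have {}ig : mu.-integrable `]1, t[ (EFin \o weak_deriv 1 T f).
  by apply: integrableS ig => //; apply: subset_itvl; rewrite bnd_simp.
have /integrableP[mg fin] := ig.
apply/integrableP; split; first exact/emeasurable_fun_itv_obnd_cbndP.
rewrite -integral_itv_obnd_cbnd//.
exact: measurableT_comp.
Qed.

Let tailE c : 1 <= c < t -> \int[mu]_(s in `[c, t[) (g1 s - g2 s) =
  (f1 t - f2 t) - (f1 c - f2 c).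
Proof.
move=> /andP[c1 ct].
have sub : `[c, t[%classic `<=` `[1, t[%classic.
  by apply: subset_itvr; rewrite bnd_simp.
have i1 := integrable_itvS sub (integrable_weak_deriv wf1).
have i2 := integrable_itvS sub (integrable_weak_deriv wf2).
have subo : `]c, t[ `<=` `[c, t[ by apply: subset_itvr; rewrite bnd_simp.
rewrite RintegralB// -!Rintegral_itv_obnd_cbnd; last 2 first.
- exact: integrable_itvS i2.
- exact: integrable_itvS i1.
rewrite (weak_deriv_FTC c1 ct tT cf1 (weak_derivP wf1)).
rewrite (weak_deriv_FTC c1 ct tT cf2 (weak_derivP wf2)).
lra.
Qed.

(** By the fundamental theorem the tail integrals of the weak derivative of
    f1 - f2 are the drops of f1 - f2 below its maximum at t, hence nonnegative;
    so the two Hadamard derivatives differ by at least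
    ln t ^ (- alpha) / Gamma (1 - alpha) times the drop from t to 1. *)
Lemma hadamard_deriv_lt : f1 1 - f2 1 < f1 t - f2 t ->
  hadamard_deriv T alpha f2 t < hadamard_deriv T alpha f1 t.
Proof.
move=> f1t; have [a0 a1] := andP alpha01.
have G0 : 0 < Gamma (1 - alpha) by apply: Gamma_gt0; lra.
rewrite /hadamard_deriv ltr_pM2l ?invr_gt0// -subr_gt0.
have subc : `[1, t[ `<=` `[1, t] by apply: subset_itvl; rewrite bnd_simp.
have j1 := integrable_itvS subc if1.
have j2 := integrable_itvS subc if2.
rewrite -!Rintegral_itv_bndo_bndc// -RintegralB//.
have E : (fun s => hadamard_integrand T alpha f1 t s -
      hadamard_integrand T alpha f2 t s) =
    (fun s => ln (t / s) `^ (- alpha) * (g1 s - g2 s)).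
  by apply/funext => s; rewrite /hadamard_integrand mulrBr.
rewrite E.
have ikg : mu.-integrable `[1, t[
    (EFin \o (fun s => ln (t / s) `^ (- alpha) * (g1 s - g2 s))).
  by rewrite -E; apply: (integrableB _ j1 j2).
have ig : mu.-integrable `[1, t[ (EFin \o (fun s => g1 s - g2 s)).
  by apply: (integrableB _ (integrable_weak_deriv wf1)
    (integrable_weak_deriv wf2)).
have k0 : 0 < ln (t / 1) `^ (- alpha).
  by apply: powR_gt0; apply: ln_ratio_gt0; rewrite lexx.
have tail_ge0 c : 1 <= c < t -> 0 <= \int[mu]_(s in `[c, t[) (g1 s - g2 s).
  by move=> ct; rewrite tailE// subr_ge0 fmax//; case/andP: ct => -> /ltW.
apply: lt_le_trans (monotone_kernel_le t1 (ltW k0) hadamard_kernel_nondecreasing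
  hadamard_kernel_continuous ig ikg tail_ge0).
by rewrite pmulr_rgt0// tailE ?lexx// subr_gt0.
Qed.
End hadamard_extremum.

(** * Comparison of two solutions *)

Section comparison.
Context {R : realType} {n : nat}.

Lemma compact_closure_bounded (G : set 'rV[R]_n) :
  bounded_set G -> compact (closure G).
Proof.
move=> [M [Mr hM]]; apply: bounded_closed_compact; last exact: closed_closure.
exists M; split => // x Mx y /= Gy.
suff : closure G `<=` closed_ball_ (fun z : 'rV[R]_n => `|z|) 0 x.
  by move=> /(_ _ Gy); rewrite /closed_ball_/= sub0r normrN.
rewrite [X in _ `<=` X](closure_id _).1; last exact: closed_closed_ball_.
apply: closureS => z Gz.
by rewrite /closed_ball_/= sub0r normrN; exact: (hM _ Mx).
Qed.

Lemma continuous_slice (A : set 'rV[R]_n) (B : set R) (u : 'rV[R]_n -> R -> R) x :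
  {within A `*` B, continuous (fun p => u p.1 p.2)} -> A x ->
  {within B, continuous (u x)}.
Proof.
move=> /subspace_continuousP cu Ax; apply/subspace_continuousP => t Bt.
have c : (x, s) @[s --> t] --> (x, t).
  apply: (@cvg_pair _ _ _ (nbhs t) (nbhs x) (nbhs t)); first exact: cvg_cst.
  exact: cvg_id.
have c' : (x, s) @[s --> within B (nbhs t)] -->
    within (A `*` B) (nbhs (x, t)).
  move=> S hS; apply: (@filterS _ (nbhs t) _ _ _ _ (c _ hS)) => s h Bs.
  exact: (h (conj Ax Bs)).
have h := cu (x, t) (conj Ax Bt).
exact: (cvg_comp (fun s => (x, s)) (fun p => u p.1 p.2) c' h).
Qed.

Variables (alpha nu T : R) (G : set 'rV[R]_n) (F : 'rV[R]_n -> R -> R -> R).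
Hypotheses (alpha01 : 0 < alpha < 1) (nu_gt0 : 0 < nu).
Hypotheses (oG : open G) (bG : bounded_set G).
Hypothesis F_noninc : forall x t, closure G x -> 1 <= t <= T ->
  forall a b, a <= b -> F x t b <= F x t a.

Lemma compact_closed_cylinder : compact (closed_cylinder G T).
Proof.
by apply: compact_setX; [exact: compact_closure_bounded|exact: segment_compact].
Qed.

(** Suppose that u1 - u2 exceeds M, and look at a point (x0, t0) where it is
    largest. There x0 is interior, t0 > 1 and u1 > u2; the Hadamard derivative of
    u1 is then strictly the larger one, whereas the right-hand side of the
    equation for u1 is at most that for u2. *)
Lemma comparison_principle (u1 u2 : 'rV[R]_n -> R -> R) (M : R) :
  classical_solution alpha nu T G F u1 ->
  classical_solution alpha nu T G F u2 ->
  0 <= M ->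
  (forall x t, boundary G x -> 1 <= t <= T -> u1 x t = u2 x t) ->
  (forall x, closure G x -> u1 x 1 - u2 x 1 <= M) ->
  forall x t, closure G x -> 1 <= t <= T -> u1 x t - u2 x t <= M.
Proof.
move=> sol1 sol2 M0 bc ic x t Gx tT.
have cw : {within closed_cylinder G T,
    continuous (fun p => u1 p.1 p.2 - u2 p.1 p.2)}.
  move=> p; apply: cvgB; first exact: (solution_continuous sol1).
  exact: (solution_continuous sol2).
have cyl0 : closed_cylinder G T !=set0 by exists (x, t); split; rewrite //= in_itv.
have [[x0 t0] + wmax] := compact_EVT_max cyl0 compact_closed_cylinder cw.
rewrite inE => -[/= Gx0]; rewrite in_itv/= => t0T.
have {}wmax y s : closure G y -> 1 <= s <= T ->
    u1 y s - u2 y s <= u1 x0 t0 - u2 x0 t0.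
  by move=> Gy sT; apply: (wmax (y, s)); rewrite inE; split; rewrite //= in_itv.
apply: (le_trans (wmax _ _ Gx tT)); rewrite leNgt; apply/negP => wM.
have x0G : G x0.
  apply: contrapT => nG; move: wM; rewrite bc ?subrr ?ltNge ?M0//.
  by split => // h; apply: nG; rewrite -((interior_id _).1 oG).
have [t01 t0leT] := andP t0T.
have {}t01 : 1 < t0.
  rewrite lt_neqAle t01 andbT; apply/eqP => t0E.
  by move: wM; rewrite -t0E ltNge ic.
have t0' : 1 < t0 <= T by rewrite t01.
have cs1 : {within `[1, T], continuous (u1 x0)}.
  exact: (continuous_slice (solution_continuous sol1) Gx0).
have cs2 : {within `[1, T], continuous (u2 x0)}.
  exact: (continuous_slice (solution_continuous sol2) Gx0).
have subG := @subset_closure _ G.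
have : hadamard_deriv T alpha (u2 x0) t0 < hadamard_deriv T alpha (u1 x0) t0.
  apply: hadamard_deriv_lt => //.
  - exact: (solution_W12 sol1).
  - exact: (solution_W12 sol2).
  - exact: (solution_integrable sol1).
  - exact: (solution_integrable sol2).
  - by move=> s /andP[s1 st]; apply: wmax => //; rewrite s1 (le_trans st).
  - by apply: le_lt_trans wM; exact: ic.
rewrite (solution_equation sol1 x0G t0') (solution_equation sol2 x0G t0').
apply/negP; rewrite -leNgt; apply: lerD.
- rewrite ler_pM2l//.
  apply: (laplacian_le_at_max oG x0G (solution_C2 sol1 t0')
    (solution_C2 sol2 t0')).
  by move=> y Gy; apply: wmax => //; exact: subG.
- by apply: F_noninc => //; rewrite -subr_ge0 (le_trans M0)// ltW.
Qed.

(** Compactness makes the image bounded; the supremum of an unbounded set would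
    be the default value 0. *)
Lemma le_sup_norm (X : topologicalType) (K : set X) (f : X -> R) x :
  compact K -> {within K, continuous f} -> K x -> `|f x| <= sup_norm K f.
Proof.
move=> cK cf Kx; apply: ub_le_sup; last by exists x.
have [M [_ hM]] := compact_bounded (continuous_compact cf cK).
exists (M + 1) => _ [y Ky <-]; apply: (hM (M + 1)); first by rewrite ltrDl.
by exists y.
Qed.

Lemma sup_norm_le (X : Type) (K : set X) (f : X -> R) M :
  K !=set0 -> (forall x, K x -> `|f x| <= M) -> sup_norm K f <= M.
Proof.
move=> [x Kx] h; apply: ge_sup; first by exists `|f x|, x.
by move=> _ [y Ky <-]; exact: h.
Qed.
End comparison.

Theorem theorem4p8 (R : realType) (n : nat) (alpha nu T : R)
    (G : set 'rV[R]_n) (F : 'rV[R]_n -> R -> R -> R)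
    (psi : 'rV[R]_n -> R -> R) (g1 g2 : 'rV[R]_n -> R)
    (u1 u2 : 'rV[R]_n -> R -> R)
    (n_gt0 : (0 < n)%N) (alpha01 : 0 < alpha < 1) (nu_gt0 : 0 < nu)
    (T_gt1 : 1 < T) (domG : smooth_bounded_domain G)
    (F_cont : {within closed_cylinder G T `*` [set: R],
                continuous (fun p => F p.1.1 p.1.2 p.2)})
    (psi_cont : {within boundary G `*` `[1, T],
                  continuous (fun p => psi p.1 p.2)})
    (g1_cont : {within closure G, continuous g1})
    (g2_cont : {within closure G, continuous g2})
    (sol1 : classical_solution alpha nu T G F u1)
    (sol2 : classical_solution alpha nu T G F u2)
    (bc1 : forall x t, boundary G x -> 1 <= t <= T -> u1 x t = psi x t)
    (bc2 : forall x t, boundary G x -> 1 <= t <= T -> u2 x t = psi x t)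
    (ic1 : forall x, closure G x -> u1 x 1 = g1 x)
    (ic2 : forall x, closure G x -> u2 x 1 = g2 x)
    (F_noninc : forall x t, closure G x -> 1 <= t <= T ->
                  forall a b, a <= b -> F x t b <= F x t a) :
  sup_norm (closed_cylinder G T) (fun p => u1 p.1 p.2 - u2 p.1 p.2)
    <= sup_norm (closure G) (fun x => g1 x - g2 x).
Proof.
have [G0 oG _ bG _] := domG.
have cG := compact_closure_bounded bG.
set M := sup_norm _ (fun x => g1 x - g2 x).
have gM x : closure G x -> `|g1 x - g2 x| <= M.
  move=> Gx; apply: (@le_sup_norm _ _ _ (fun x => g1 x - g2 x)) => // y.
  by apply: cvgB; [exact: g1_cont|exact: g2_cont].
have [x0 Gx0] := G0.
have Gx0' : closure G x0 by exact: subset_closure.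
have M0 : 0 <= M by apply: le_trans (gM _ Gx0').
have bc x t : boundary G x -> 1 <= t <= T -> u1 x t = u2 x t.
  by move=> bx tT; rewrite bc1// bc2.
apply: sup_norm_le.
  by exists (x0, 1); split; rewrite //= in_itv/= lexx ltW.
move=> [x t] [/= Gx]; rewrite in_itv/= => tT.
rewrite ler_norml lerNl opprB; apply/andP; split.
- apply: (comparison_principle alpha01 nu_gt0 oG bG F_noninc sol2 sol1) => //.
  + by move=> y s By sT; rewrite bc.
  + by move=> y Gy; rewrite ic1// ic2// (le_trans (ler_norm _))// distrC gM.
- apply: (comparison_principle alpha01 nu_gt0 oG bG F_noninc sol1 sol2) => //.
  by move=> y Gy; rewrite ic1// ic2// (le_trans (ler_norm _))// gM.
Qed.
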